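(* Let $X$ and $Y$ be metrizable topological vector spaces, each of cardinality $\mathfrak{c}$. Then there exists a function $F\colon X\to Y$ satisfying $F(x+u)=F(x)+F(u)$ for all $x,u\in X$ whose graph is a connected and dense subset of $X\times Y$.
   Context: $\mathfrak{c}$ denotes the cardinality of the continuum. Topological vector spaces are over $\mathbb{R}$ or $\mathbb{C}$ with its usual topology. The product $X\times Y$ carries the product topology, and the graph of $F$ is $\{(x,F(x))\colon x\in X\}\subset X\times Y$; it is called connected if it is connected in the subspace topology. *)

(* Defs.v *)
From mathcomp Require Import all_boot all_order all_algebra.
From mathcomp Require Import all_classical all_reals all_analysis.
From mathcomp Require Import complex.
Set Implicit Arguments.
Unset Strict Implicit.
Unset Printing Implicit Defensive.
Import Order.TTheory GRing.Theory Num.Theory.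
Local Open Scope classical_set_scope.
Local Open Scope ring_scope.

Variant scalar_kind := RealScalars | ComplexScalars.

(* The scalar field of a topological vector space: R or C. A value V of
   [topologicalLmodType (scalars R k)] is a vector space with jointly continuous
   addition and scalar multiplication, where the scalars carry the topology of
   their absolute value; unlike [tvsType], it is not assumed locally convex. *)
Definition scalars (R : realType) (k : scalar_kind) : numFieldType :=
  match k with
  | RealScalars => R
  | ComplexScalars => R[i]
  end.

Definition is_metric (R : realType) (T : Type) (d : T -> T -> R) : Prop :=
  [/\ forall x y, 0 <= d x y,
      forall x y, d x y = 0 <-> x = y,
      forall x y, d x y = d y x
    & forall x y z, d x z <= d x y + d y z].

Definition metrizable (R : realType) (T : topologicalType) : Prop :=
  exists2 d : T -> T -> R, is_metric d &
    forall A : set T, open A <->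
      forall x, A x -> exists2 e : R, 0 < e & [set y | d x y < e] `<=` A.

Definition graph (X Y : Type) (F : X -> Y) : set (X * Y) :=
  range (fun x => (x, F x)).

(* Main.v *)
Require Import Defs.
From mathcomp Require Import all_boot all_order all_algebra.
From mathcomp Require Import all_classical all_reals all_analysis.
From mathcomp Require Import complex ring.
From mathcomp Require wochoice.
Set Implicit Arguments.
Unset Strict Implicit.
Unset Printing Implicit Defensive.
Import Order.TTheory GRing.Theory Num.Theory.
Import numFieldNormedType.Exports.
Local Open Scope classical_set_scope.
Local Open Scope ring_scope.

(** The additive map is built so that its graph meets many prescribed subsets of
X * Y, few enough to be listed by a set of size continuum and yet enough to
force density and connectedness.  Because X need not be separable, the closed
subsets of X * Y can be too numerous to list, so only sets lying in images of
the plane are prescribed.  Given a, e in X with e <> 0, given b, f in Y and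
an open D in the plane, suppose that every vertical line over [-1, 1] leaves D;
then some point (a + s e, b + r f) with |s| <= 1 and (s, r) outside D has to lie
on the graph ([strip_hitting]).  An open set of the plane is a union of rational
balls, so there are only continuum many such requirements.

Density: take f = 0 and D empty, with e short and (a, b) in the given open set.

Connectedness: suppose that two open sets U and V separate the graph.  By
density they are disjoint.  The sets of those x whose vertical fibre meets U,
respectively V, are open and cover X, because (x, F x) lies in U or in V; moving
along a real line of X one finds a point a whose fibre meets both, say (a, b)
in U and (a, d) in V.  For e short, every (a + s e, b) is in U and every
(a + s e, d) is in V, so the real line joining these two points leaves the union
of U and V, being connected.  The requirement for f = d - b and for D the
trace of that union then gives a point of the graph outside of it.

Existence: requirements are treated along a well-order all of whose initial
segments are strictly smaller than the set of requirements
([small_segments_well_order]).  At each stage a point (x, y) is added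
whose x is independent, over the rationals, of the first coordinates already
used; the additive map on the span of the chosen points then extends to X.
Such an x exists because the admissible ones fill a segment a + [-1, 1] e,
whose rational span contains the real line through e.  That line
contains a rationally independent family of size continuum
([branch_real_independent]), which cannot be spanned by a smaller set
([steinitz_exchange]).

Linear algebra over the rationals is phrased inside abelian groups: a rational
subspace of a rational vector space is the same as a pure subgroup, i.e. one
containing x as soon as it contains a positive multiple of x.  This handles
real spaces, complex spaces and their products alike, without any choice of
scalars. *)

(** * Pure subgroups and rational spans *)

Definition pure_subgroup (V : zmodType) (W : set V) : Prop :=
  [/\ W 0, forall x y, W x -> W y -> W (x - y)
    & forall n x, W (x *+ n.+1) -> W x].

Definition qspan (V : zmodType) (A : set V) : set V :=
  \bigcap_(W in [set W | pure_subgroup W /\ A `<=` W]) W.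

Lemma sub_qspan (V : zmodType) (A : set V) : A `<=` qspan A.
Proof. by move=> x Ax W [_]; apply. Qed.

Lemma qspan_min (V : zmodType) (A W : set V) :
  pure_subgroup W -> A `<=` W -> qspan A `<=` W.
Proof. by move=> pW AW x; apply. Qed.

Lemma qspan_pure (V : zmodType) (A : set V) : pure_subgroup (qspan A).
Proof.
split=> [W [[]]//|x y Ax Ay W WA|n x Ax W WA].
  by case: (WA) => -[_ WB _] _; apply: WB; [apply: Ax|apply: Ay].
by case: (WA) => -[_ _ WM] _; apply: (WM n); apply: Ax.
Qed.

Lemma qspan_subset (V : zmodType) (A B : set V) :
  A `<=` B -> qspan A `<=` qspan B.
Proof.
by move=> AB; apply: qspan_min (qspan_pure B) _ => x /AB; exact: sub_qspan.
Qed.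

Lemma pureN (V : zmodType) (W : set V) x : pure_subgroup W -> W x -> W (- x).
Proof. by case=> W0 WB _ Wx; rewrite -sub0r; exact: WB. Qed.

Lemma pureD (V : zmodType) (W : set V) x y :
  pure_subgroup W -> W x -> W y -> W (x + y).
Proof.
move=> pW Wx Wy; rewrite -[y]opprK; case: (pW) => _ WB _.
by apply: WB => //; exact: pureN.
Qed.

Lemma pureMn (V : zmodType) (W : set V) x n :
  pure_subgroup W -> W x -> W (x *+ n).
Proof.
move=> pW Wx; elim: n => [|n IHn]; first by case: pW.
by rewrite mulrS; exact: pureD.
Qed.

Lemma pure_divz (V : zmodType) (W : set V) x m :
  pure_subgroup W -> m != 0 -> W (x *~ m) -> W x.
Proof.
move=> pW; case: (pW) => _ _ WM; case: m => [[|n]//|n] _ /=; first exact: WM.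
by move=> /(pureN pW); rewrite opprK; apply: WM.
Qed.

(** An integer multiple in place of a rational one: clearing denominators avoids
any scalar action of the rationals. *)
Lemma qspan_setU1 (V : zmodType) (A : set V) a x : qspan (A `|` [set a]) x ->
  exists n : nat, exists m : int, qspan A (x *+ n.+1 - a *~ m).
Proof.
have pA := qspan_pure A; case: (pA) => A0 AB AM.
apply: (qspan_min (W := [set x | exists n : nat, exists m : int,
  qspan A (x *+ n.+1 - a *~ m)])); last first.
  move=> y [Ay|->].
    by exists 0%N, 0; rewrite mulr0z subr0; exact: sub_qspan.
  by exists 0%N, 1; rewrite mulr1z subrr.
split=> [|y z [n [m Ay]] [n' [m' Az]]|k y [n [m Ay]]].
- by exists 0%N, 0; rewrite mulr0z subr0.
(* product of the two multipliers, which are successors *)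
- exists (n.+1 * n'.+1).-1, (m * n'.+1%:Z - m' * n.+1%:Z).
  have -> : (y - z) *+ (n.+1 * n'.+1).-1.+1
      - a *~ (m * n'.+1%:Z - m' * n.+1%:Z) =
     (y *+ n.+1 - a *~ m) *+ n'.+1 - (z *+ n'.+1 - a *~ m') *+ n.+1.
    rewrite prednK ?muln_gt0// !mulrnBl -!mulrnA [(n'.+1 * n.+1)%N]mulnC.
    rewrite mulrzBr !mulrzA -!pmulrn !opprB addrACA [RHS]addrACA.
    by congr (_ + _); exact: addrC.
  by apply: AB; exact: (pureMn _ pA).
- exists (k.+1 * n.+1).-1, m.
  by rewrite prednK ?muln_gt0// mulrnA.
Qed.

(** In a relation n x = m a modulo the span of A the coefficient m is nonzero,
as otherwise x would lie in that span; dividing by m is purity. *)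
Lemma qspan_exchange (V : zmodType) (A : set V) a x :
  qspan (A `|` [set a]) x -> ~ qspan A x -> qspan (A `|` [set x]) a.
Proof.
move=> /qspan_setU1[n [m Axa]] nAx; have pAx := qspan_pure (A `|` [set x]).
have m0 : m != 0.
  apply/eqP => m0; apply: nAx; case: (qspan_pure A) => _ _; apply.
  by move: Axa; rewrite m0 mulr0z subr0; apply.
apply: (pure_divz pAx m0).
rewrite -[a *~ m]opprK -[- (a *~ m)](addrK (x *+ n.+1)) [- (a *~ m) + _]addrC.
rewrite opprB; case: (pAx) => _ AB _; apply: AB.
  by apply: (pureMn _ pAx); apply: sub_qspan; right.
by apply: qspan_subset Axa; left.
Qed.

(** Spans have finite character.  Only chains occur below, and for a chain the
union of the spans is itself a pure subgroup, so no finite combination has to be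
written down.  The fixed set B takes care of the empty chain. *)
Lemma qspan_bigcup_chain (V : zmodType) (B : set V) (F : set (set V)) x :
  total_on F subset -> qspan (B `|` \bigcup_(A in F) A) x ->
  qspan B x \/ exists2 A, F A & qspan (B `|` A) x.
Proof.
move=> totF.
apply: (qspan_min (W := [set x | qspan B x \/
    exists2 A, F A & qspan (B `|` A) x])); last first.
  move=> y [By|[A FA Ay]]; first by left; exact: sub_qspan.
  by right; exists A => //; apply: sub_qspan; right.
have mono A : qspan B `<=` qspan (B `|` A) by apply: qspan_subset => ?; left.
split=> [|y z|n y].
- by left; case: (qspan_pure B).
- move=> [By|[A FA Ay]] [Bz|[C FC Cz]].
  + by left; case: (qspan_pure B) => _ BB _; exact: BB.
  + right; exists C => //; case: (qspan_pure (B `|` C)) => _ BB _.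
    by apply: BB => //; exact: mono.
  + right; exists A => //; case: (qspan_pure (B `|` A)) => _ BB _.
    by apply: BB => //; exact: mono.
  + have [AC|CA] := totF _ _ FA FC; right.
      exists C => //; case: (qspan_pure (B `|` C)) => _ BB _.
      by apply: BB => //; apply: qspan_subset Ay; exact: setUS.
    exists A => //; case: (qspan_pure (B `|` A)) => _ BB _.
    by apply: BB => //; apply: qspan_subset Cz; exact: setUS.
- case=> [By|[A FA Ay]].
    by left; case: (qspan_pure B) => _ _ BM; exact: BM By.
  right; exists A => //.
  by case: (qspan_pure (B `|` A)) => _ _ BM; exact: BM Ay.
Qed.

(** * The exchange property for infinite families *)

Definition independent (I : Type) (V : zmodType) (t : I -> V) : Prop :=
  forall i, ~ qspan (t @` [set j | j <> i]) (t i).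

(** The graph of a family: G is a partial function whose values take the place of
those of t. *)
Definition exchanged (I : Type) (V : zmodType) (t : I -> V) (G : set (I * V)) :
  set (I * V) :=
  G `|` [set p | p.2 = t p.1 /\ ~ exists y, G (p.1, y)].

Definition other_values (I V : Type) (H : set (I * V)) (i : I) : set V :=
  [set y | exists2 j, j <> i & H (j, y)].

(** An independent family is no larger than a set spanning it. For infinite
families one usually counts finite subsets; here Zorn's lemma is applied instead
to the partial injections G of I into A for which the family [exchanged t G] is
still independent. This passes to unions of chains by finite character. If G is
maximal but not defined at i, then some a in A lies outside the span of the
other members, since otherwise t i would be in that span, and i can be sent to
a. *)
Lemma steinitz_exchange (I : Type) (V : zmodType) (t : I -> V) (A : set V) :
  independent t -> (forall i, qspan A (t i)) ->
  exists f : I -> V, injective f /\ forall i, A (f i).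
Proof.
move=> tI tA.
pose good (G : set (I * V)) := [/\ forall i y, G (i, y) -> A y,
  forall i y z, G (i, y) -> G (i, z) -> y = z &
  forall i x, exchanged t G (i, x) ->
    ~ qspan (other_values (exchanged t G) i) x].
(* the first goal: such partial injections are closed under unions of chains *)
have [F FG totF|G [[GA Gfun Gind] Gmax]] := @Zorn_bigcup _ good.
  split=> [i y [H FH]|i y z [H FH Hy] [H' FH' Hz]|i x Gix].
  - by have [HA _ _] := FG _ FH; exact: HA.
  - have [HH'|H'H] := totF _ _ FH FH'.
      by have [_ Hf _] := FG _ FH'; apply: (Hf i) => //; exact: HH'.
    by have [_ Hf _] := FG _ FH; apply: (Hf i) => //; exact: H'H.
  - pose U := \bigcup_(H in F) H.
    pose Ri := [set y | exists2 j, j <> i & y = t j /\ ~ exists z, U (j, z)].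
    have others_sub H : F H ->
        Ri `|` other_values H i `<=` other_values (exchanged t H) i.
      move=> FH y [[j ji [yE nU]]|[j ji Hy]]; exists j => //; last by left.
      by right; split=> // -[z Hz]; apply: nU; exists z; exists H.
    have sub_others : other_values (exchanged t U) i `<=`
        Ri `|` \bigcup_(B in [set other_values H i | H in F]) B.
      move=> y [j ji [[H FH Hy]|[/= yE nU]]]; last by left; exists j.
      by right; exists (other_values H i); [exists H|exists j].
    move=> /(qspan_subset sub_others) /qspan_bigcup_chain[|Rx|].
    + move=> _ _ [H FH <-] [H' FH' <-].
      have [HH'|H'H] := totF _ _ FH FH'; [left|right];
        by move=> y [j ji Hy]; exists j => //; auto.
    + case: Gix => [[H FH Hix]|[/= xE nU]].
        have [_ _ /(_ i x)] := FG _ FH; apply; first by left.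
        by apply: qspan_subset Rx => y Ry; apply: others_sub FH _ _; left.
      apply: (tI i); rewrite -xE; apply: qspan_subset Rx => y [j ji [-> _]].
      by exists j.
    + move=> [_ [H FH <-] Hx].
      have main H' : F H' -> H `<=` H' -> exchanged t H' (i, x) -> False.
        move=> FH' HH' H'ix; have [_ _ /(_ i x H'ix)] := FG _ FH'; apply.
        apply: qspan_subset Hx => y RHy; apply: others_sub FH' _ _.
        by case: RHy => [|[j ji Hy]]; [left|right; exists j => //; exact: HH'].
      case: Gix => [[H' FH' H'ix]|[/= xE nU]].
        have [HH'|H'H] := totF _ _ FH FH'.
          by apply: main HH' _ => //; left.
        by apply: (main H) => //; left; exact: H'H.
      apply: (main H) => //; right; split=> // -[z Hz].
      by apply: nU; exists z; exists H.
have Gtot i : exists y, G (i, y).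
  apply: contrapT => nGi.
  (* the member at i is not spanned by the others, so neither is all of A *)
  have [a Aa na] : exists2 a, A a & ~ qspan (other_values (exchanged t G) i) a.
    apply: contrapT => nA; apply: (Gind i (t i)); first by right.
    apply: qspan_min (tA i); first exact: qspan_pure.
    by move=> a Aa; apply: contrapT => na; apply: nA; exists a.
  pose G' := G `|` [set (i, a)].
  apply: (Gmax G').
    split; first by move=> ?; left.
    by move=> /(_ (i, a)) Gia; apply: nGi; exists a; apply: Gia; right.
  have exchangedG' j y : j <> i ->
      exchanged t G' (j, y) -> exchanged t G (j, y).
    move=> ji [[|[/ji]//]|[/= yE nG']]; [by left|right; split=> // -[z Gz]].
    by apply: nG'; exists z; left.
  have G'i y : exchanged t G' (i, y) -> y = a.
    move=> [[Giy|[]//]|[/= _ []]]; last by exists a; right.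
    by case: nGi; exists y.
  split=> [j y [/GA//|[_ ->]//]|j y z|j x].
  - move=> [Gy|[ji ya]] [Gz|[ji' za]].
    + exact: Gfun Gy Gz.
    + by case: nGi; exists y; rewrite -ji'.
    + by case: nGi; exists z; rewrite -ji.
    + by rewrite ya za.
  - have [->{j}|ji Gjx] := EM (j = i).
      move=> /G'i -> ax; apply: na; apply: qspan_subset ax.
      by move=> y [j ji /(exchangedG' _ _ ji)]; exists j.
    (* a relation for the member x at j has to involve a, and exchanging x with
       a would put a in the span of the members other than the one at i *)
    pose C := [set y | exists2 k, k <> j & k <> i /\ exchanged t G (k, y)].
    have CG : C `<=` other_values (exchanged t G) j.
      by move=> y [k kj [_ Gk]]; exists k.
    move=> xC; have {xC} : qspan (C `|` [set a]) x.
      apply: qspan_subset xC => y [k kj Gky].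
      have [ki|ki] := EM (k = i); first by right; move: Gky; rewrite ki => /G'i.
      by left; exists k => //; split=> //; exact: exchangedG'.
    move=> /qspan_exchange xC; apply: na.
    have {}xC : qspan (C `|` [set x]) a.
      by apply: xC => /(qspan_subset CG); apply: Gind; exact: exchangedG'.
    apply: qspan_subset xC => y [[k kj [ki Gk]]|->]; first by exists k.
    by exists j => //; exact: exchangedG'.
have [f Gf] := choice Gtot.
exists f; split=> [i j fij|i]; last exact: GA (Gf i).
apply: contrapT => ij; apply: (Gind i (f i)); first by left.
apply: sub_qspan; exists j; first exact/nesym.
by left; rewrite fij.
Qed.

(** * Continuum many rationally independent reals *)

Definition factorial_sum (R : realType) (d : nat -> int) : R^nat :=
  fun n => \sum_(0 <= k < n) (d k)%:~R / k`!%:R.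

(** The bound telescopes since
1/(p p!) - 1/((p+1) (p+1)!) >= 1/(p+1)! for p >= 1. *)
Lemma factorial_sum_tail (R : realType) (M : nat) (d : nat -> int) n m :
  (forall k, `|d k| <= M%:Z) ->
  `|factorial_sum R d (n.+2 + m)%N - factorial_sum R d n.+2| <=
    M%:R * ((n.+1 * n.+1`!)%N%:R^-1 -
      ((n.+1 + m) * (n.+1 + m)`!)%N%:R^-1).
Proof.
move=> dM; elim: m => [|m IHm].
  by rewrite !addn0 !subrr normr0 mulr0.
rewrite addnS /factorial_sum big_nat_recr//= -/(factorial_sum R d _).
rewrite addrAC; apply: (le_trans (ler_normD _ _)).
apply: (le_trans (lerD IHm (lexx _))).
rewrite -lerBrDl -mulrBr opprB [X in _ <= _ * X]addrC addrA subrK.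
rewrite normrM normfV normr_nat.
apply: (@le_trans _ _ (M%:R / (n.+2 + m)%N`!%:R)).
  rewrite ler_wpM2r ?invr_ge0//.
  by rewrite -intr_norm -[M%:R]/((M%:Z)%:~R) ler_int.
rewrite ler_wpM2l// !addSn !addnS.
set N := (n + m)%N.
have N0 : (0 : R) < N.+1`!%:R by rewrite ltr0n fact_gt0.
have NS : (0 : R) < N.+1%:R by rewrite ltr0n.
have fS : N.+2`!%:R = N.+2%:R * N.+1`!%:R :> R by rewrite -natrM -factS.
rewrite [(_ * N.+1`!)%N%:R]natrM [(_ * N.+2`!)%N%:R]natrM fS.
have -> : N.+2%:R = N.+1%:R + 1 :> R by rewrite natr1.
move: N.+1%:R N.+1`!%:R N0 NS => a f f0 a0; rewrite -subr_ge0.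
have a1 : 0 < a + 1 by rewrite addr_gt0.
have -> : (a * f)^-1 - ((a + 1) * ((a + 1) * f))^-1 - ((a + 1) * f)^-1 =
    (a * (a + 1) * (a + 1) * f)^-1.
  by field; rewrite !gt_eqF.
by rewrite invr_ge0 !mulr_ge0 ?ltW.
Qed.

Lemma factorial_sum_int (R : realType) (d : nat -> int) n :
  exists z : int, factorial_sum R d n.+1 * n`!%:R = z%:~R.
Proof.
elim: n => [|n [z zE]].
  by exists (d 0%N); rewrite /factorial_sum big_nat1 fact0 divr1 mulr1.
exists (z * n.+1%:Z + d n.+1).
rewrite /factorial_sum big_nat_recr//= -/(factorial_sum R d _) mulrDl.
rewrite divfK ?pnatr_eq0 -?lt0n ?fact_gt0// (factS n) natrM mulrCA mulrC zE.
by rewrite intrD intrM.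
Qed.

(** Multiplied by n!, the partial sum up to n is an integer; when the whole sum
is 0 it equals minus the tail, which is less than 1 in absolute value as soon as
n exceeds the bound on d.  Hence the partial sums vanish from some point on, and
so do the digits. *)
Lemma factorial_sum_eq0 (R : realType) (M : nat) (d : nat -> int) :
  (forall k, `|d k| <= M%:Z) -> factorial_sum R d @ \oo --> (0 : R) ->
  exists K, forall k, (K <= k)%N -> d k = 0.
Proof.
move=> dM d0; exists M.+2 => k Mk.
have Pn n : (M <= n)%N -> factorial_sum R d n.+2 = 0.
  move=> Mn.
  have Pb : `|factorial_sum R d n.+2| <= M%:R / (n.+1 * n.+1`!)%N%:R.
    have cv : `|factorial_sum R d (n.+2 + m)%N - factorial_sum R d n.+2|
        @[m --> \oo] --> `|0 - factorial_sum R d n.+2|.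
      apply: cvg_norm; apply: cvgB; last exact: cvg_cst.
      move: d0; rewrite -(cvg_shiftn n.+2).
      by under eq_fun do rewrite addnC.
    move: cv; rewrite sub0r normrN => cv.
    apply: (@ler_cvg_to _ _ _ _ _ (cst (M%:R / (n.+1 * n.+1`!)%N%:R))
      _ _ cv (cvg_cst _)).
    near=> m; apply: (le_trans (factorial_sum_tail _ _ _ dM)).
    by rewrite ler_wpM2l// lerBlDr lerDl invr_ge0.
  have [z zE] := factorial_sum_int R d n.+1.
  (* Pb bounds |z| by M / (n + 1) < 1 *)
  have f0 : (0 : R) < n.+1`!%:R by rewrite ltr0n fact_gt0.
  have : `|z%:~R : R| < 1.
    rewrite -zE normrM normr_nat -ltr_pdivlMr// mul1r.
    apply: (le_lt_trans Pb); rewrite natrM invfM mulrA gtr_pMl ?invr_gt0//.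
    by rewrite ltr_pdivrMr// mul1r ltr_nat ltnS.
  rewrite -intr_norm -[1 : R]/((1%:Z)%:~R) ltr_int => z1.
  have z0 : z = 0 by move: z1; case: (z) => [[|?]|].
  by move/eqP: zE; rewrite z0 mulf_eq0 (gt_eqF f0) orbF => /eqP.
case: k Mk => [//|[//|k]]; rewrite !ltnS => Mk.
have := Pn k.+1 (leqW Mk).
rewrite /factorial_sum big_nat_recr//= -/(factorial_sum R d _) Pn//.
rewrite add0r => /eqP; rewrite mulf_eq0 invr_eq0 pnatr_eq0 -[_`! == _]leqn0.
by rewrite leqNgt fact_gt0 orbF intr_eq0 => /eqP.
Unshelve. all: end_near.
Qed.

Lemma factorial_sum_lin (R : realType) (d e : nat -> int) (a b : int)
    (u v : R) :
  factorial_sum R d @ \oo --> u -> factorial_sum R e @ \oo --> v ->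
  factorial_sum R (fun k => d k * a - e k * b) @ \oo --> u *~ a - v *~ b.
Proof.
move=> du ev.
rewrite (_ : factorial_sum R _ =
    (fun n => factorial_sum R d n * a%:~R - factorial_sum R e n * b%:~R)).
  by rewrite -[u *~ _]mulrzr -[v *~ _]mulrzr; apply: cvgB; exact: cvgMl.
apply/funext => n; rewrite /factorial_sum !mulr_suml -sumrB.
apply: eq_bigr => k _; rewrite intrB !intrM mulrBl.
by congr (_ - _); rewrite mulrAC.
Qed.

(** k codes a finite initial segment of the infinite binary word x, i.e. a node
of the binary tree on the branch x.  Distinct branches share only finitely
many nodes. *)
Definition on_branch (x : nat -> bool) (k : nat) : bool :=
  if unpickle k is Some s then s == mkseq x (size s) else false.

Lemma on_branchE (x y : nat -> bool) n :
  on_branch x (pickle (mkseq y n)) = (mkseq y n == mkseq x n).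
Proof. by rewrite /on_branch pickleK size_mkseq. Qed.

Lemma injective_unbounded (f : nat -> nat) L K :
  injective f -> exists2 n, (L <= n)%N & (K <= f n)%N.
Proof.
move=> f_inj; apply: contrapT => nK.
have : (size [seq f n | n <- iota L K.+1] <= size (iota 0 K))%N.
  apply: uniq_leq_size; first by rewrite map_inj_uniq// iota_uniq.
  move=> _ /mapP[n + ->]; rewrite !mem_iota => /andP[Ln _] /=.
  by rewrite add0n ltnNge; apply/negP => Kfn; apply: nK; exists n.
by rewrite size_map !size_iota ltnn.
Qed.

Definition branch_real (R : realType) (x : nat -> bool) : R :=
  limn (factorial_sum R (fun k => (on_branch x k : nat)%:Z)).

Lemma branch_real_cvg (R : realType) (x : nat -> bool) :
  factorial_sum R (fun k => (on_branch x k : nat)%:Z) @ \oo --> branch_real R x.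
Proof.
apply: (@series_le_cvg R (fun k => ((on_branch x k : nat)%:Z)%:~R / k`!%:R)
  (exp_coeff (1 : R))) => [k|k|k|].
- by rewrite divr_ge0// ler0z.
- by rewrite /exp_coeff /= divr_ge0// exprn_ge0.
- rewrite /exp_coeff /= expr1n ler_wpM2r ?invr_ge0//.
  by case: on_branch.
- exact: is_cvg_series_exp_coeff.
Qed.

(** The reals having a multiple with a bounded digit sequence that vanishes at
all long enough nodes of the branch x form a pure subgroup. It contains the real
of any other branch. If it contained that of x, then N times this real would be
a sum whose digits are 0 at infinitely many nodes where they should be N,
contradicting the uniqueness of digits given by [factorial_sum_eq0]. *)
Lemma branch_real_independent (R : realType) : independent (branch_real R).
Proof.
move=> x.
pose null (d : nat -> int) := exists L, forall n, (L <= n)%N ->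
  d (pickle (mkseq x n)) = 0.
pose bounded (d : nat -> int) := exists M : nat, forall k, `|d k| <= M%:Z.
pose W := [set v : R | exists N d,
  [/\ bounded d, null d & factorial_sum R d @ \oo --> v *+ N.+1]].
have bounded_lin d e (a b : int) : bounded d -> bounded e ->
    bounded (fun k => d k * a - e k * b).
  move=> [M dM] [M' eM']; exists (M * `|a| + M' * `|b|)%N => k.
  rewrite PoszD !PoszM !abszE; apply: (le_trans (ler_normB _ _)).
  by rewrite !normrM lerD// ler_wpM2r.
have bounded_branch y : bounded (fun k => (on_branch y k : nat)%:Z).
  by exists 1%N => k; case: on_branch.
have pW : pure_subgroup W.
  split.
  - exists 0%N, (fun=> 0); split; [by exists 0%N => k|by exists 0%N|].
    rewrite mul0rn (_ : factorial_sum R _ = fun=> 0); first exact: cvg_cst.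
    by apply/funext => n; rewrite /factorial_sum big1// => k _; rewrite mul0r.
  - move=> u v [N [d [db [L dL] du]]] [N' [e [eb [L' eL'] ev]]].
    exists (N.+1 * N'.+1).-1, (fun k => d k * N'.+1%:Z - e k * N.+1%:Z); split.
    + exact: bounded_lin.
    + exists (maxn L L') => n; rewrite geq_max => /andP[Ln L'n].
      by rewrite dL// eL'// !mul0r subr0.
    + rewrite prednK ?muln_gt0// mulrnBl mulrnA mulnC mulrnA.
      have := factorial_sum_lin (a := N'.+1%:Z) (b := N.+1%:Z) du ev.
      by rewrite -!pmulrn.
  - move=> n v [N [d dP]]; exists (n.+1 * N.+1).-1, d.
    by rewrite prednK ?muln_gt0// mulrnA.
have TW y : y <> x -> W (branch_real R y).
  move=> yx; exists 0%N, (fun k => (on_branch y k : nat)%:Z); split=> //.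
    have [L xyL] : exists L, x L <> y L.
      apply: contrapT => nL; apply: yx; apply/funext => n.
      by apply: contrapT => yxn; apply: nL; exists n => /esym.
    exists L.+1 => n Ln; rewrite on_branchE.
    case: eqP => // /(congr1 (fun s => nth false s L)).
    by rewrite !nth_mkseq.
  exact: branch_real_cvg.
move=> Tx; have {Tx} : W (branch_real R x).
  by apply: qspan_min Tx => // _ [y yx <-]; exact: TW.
move=> [N [d [db [L dL] du]]].
have := factorial_sum_lin (a := N.+1%:Z) (b := 1) (@branch_real_cvg R x) du.
rewrite mulr1z -pmulrn subrr.
have [M eM] := bounded_lin _ _ N.+1%:Z 1 (bounded_branch x) db.
move=> /(factorial_sum_eq0 eM)[K e0].
have [|n Ln Kn] := @injective_unbounded (fun n => pickle (mkseq x n)) L K.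
  move=> m n /(pcan_inj pickleK) /(congr1 size).
  by rewrite !size_mkseq.
by have := e0 _ Kn; rewrite dL// on_branchE eqxx mul1r mul0r subr0.
Qed.

(** * Well-orders and transfinite choice *)

(** Start from any well-order.  If some initial segment admits an injection of
the whole type, take the least such segment and pull the order back along the
injection: an initial segment of the new order that received the whole type
would give a smaller such segment of the old one. *)
Lemma small_segments_well_order (T : Type) : exists lt : T -> T -> Prop,
  [/\ well_founded lt, forall x y z, lt x y -> lt y z -> lt x z,
      forall x y, [\/ lt x y, x = y | lt y x]
    & forall y (f : T -> T), injective f -> ~ forall x, lt (f x) y].
Proof.
elim/Peq: T => T.
have [R Rwo] := wochoice.well_ordering_principle T.
pose lt x y := R x y /\ x <> y.
have Rmin (P : T -> Prop) x : P x ->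
    exists m, P m /\ forall y, P y -> R m y.
  move=> Px; have [|m [[mP mmin] _]] := Rwo (fun z => `[< P z >]).
    by exists x; exact/asboolP.
  exists m; split; first exact/asboolP.
  by move=> y /asboolP; exact: mmin.
have Rtot x y : R x y \/ R y x.
  have [m [[->|->] mP]] := Rmin (fun z => z = x \/ z = y) x (or_introl erefl).
    by left; apply: mP; right.
  by right; apply: mP; left.
have Ranti x y : R x y -> R y x -> x = y.
  move=> xy yx.
  have [|m [_ mu]] := Rwo (fun z => `[< z = x \/ z = y >]).
    by exists x; apply/asboolP; left.
  have Rxx z : R z z by case: (Rtot z z).
  rewrite -(mu x) ?(mu y)//; split.
  - by apply/asboolP; right.
  - by move=> z /asboolP [->|->].
  - by apply/asboolP; left.
  - by move=> z /asboolP [->|->].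
have Rtrans x y z : R x y -> R y z -> R x z.
  move=> xy yz.
  have [m [mE mP]] :=
    Rmin (fun w => [\/ w = x, w = y | w = z]) x (Or31 _ _ erefl).
  have mx : R m x by apply: mP; constructor 1.
  have my : R m y by apply: mP; constructor 2.
  have mz : R m z by apply: mP; constructor 3.
  case: mE => mE; first by rewrite -mE.
    by rewrite (Ranti x y xy)// -mE.
  by rewrite -(Ranti y z yz)// -mE.
have lt_trans x y z : lt x y -> lt y z -> lt x z.
  move=> [xy nxy] [yz nyz]; split; first exact: Rtrans yz.
  by move=> xz; apply: nxy; apply: Ranti => //; rewrite xz.
have lt_wf : well_founded lt.
  move=> x; apply: contrapT => /(Rmin (fun z => ~ Acc lt z))[m [mA mP]].
  apply: mA; constructor => y [ym nym]; apply: contrapT => /mP my.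
  exact/nym/Ranti.
have lt_tri x y : [\/ lt x y, x = y | lt y x].
  have [->|xy] := EM (x = y); first by constructor 2.
  have [Rxy|Ryx] := Rtot x y; first by constructor 1.
  by constructor 3; split=> // /esym.
pose bad y := exists f : T -> T, injective f /\ forall x, lt (f x) y.
have [[y0 /(Rmin bad)[y [[f [f_inj fy]] ymin]]]|nbad] := EM (exists y, bad y);
  last first.
  by exists lt; split=> // y f f_inj fy; apply: nbad; exists y, f.
exists (fun x z => lt (f x) (f z)); split.
- move=> x; move: {2}(f x) (erefl (f x)) => u.
  elim/(well_founded_ind lt_wf): u x => u IHu x xu; constructor => z.
  by rewrite xu => /IHu; apply.
- by move=> x z w; exact: lt_trans.
- move=> x z; case: (lt_tri (f x) (f z)); first by constructor 1.
    by move=> /f_inj; constructor 2.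
  by constructor 3.
- move=> z g g_inj gz; have [fzy nfzy] := fy z.
  apply/nfzy/Ranti => //; apply: ymin; exists (f \o g); split=> //.
  exact: inj_comp.
Qed.

Lemma well_founded_choice (I Z : Type) (z0 : Z) (lt : I -> I -> Prop)
    (P : I -> set Z -> Z -> Prop) :
  well_founded lt ->
  (forall i (f : I -> Z), exists z, P i (f @` [set j | lt j i]) z) ->
  exists z : I -> Z, forall i, P i (z @` [set j | lt j i]) (z i).
Proof.
move=> wf PE.
have /choice[g gP] (p : I * set Z) :
    exists z, (exists w, P p.1 p.2 w) -> P p.1 p.2 z.
  have [[w Pw]|nP] := EM (exists w, P p.1 p.2 w); first by exists w.
  by exists z0.
pose step i (rec : forall j, lt j i -> Z) :=
  g (i, [set w | exists j (ji : lt j i), rec j ji = w]).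
pose z := Fix wf (fun=> Z) step.
have zE i : z i = g (i, z @` [set j | lt j i]).
  rewrite {1}/z Fix_eq; last first.
    move=> j f h fh; rewrite /step; congr (g (_, _)).
    by apply/seteqP; split=> w [k [kj <-]]; exists k, kj; rewrite fh.
  congr (g (_, _)).
  by apply/seteqP; split=> w [j]; [move=> [ji <-]; exists j|
    move=> ji <-; exists j, ji].
by exists z => i; rewrite zE; exact: (gP (i, _) (PE i z)).
Qed.

(** * Extending partial additive maps *)

Definition divisible (V : zmodType) : Prop :=
  forall n (x : V), exists y, y *+ n.+1 = x.

Definition torsion_free (V : zmodType) : Prop :=
  forall n (x : V), x *+ n.+1 = 0 -> x = 0.

(** The span of G is the graph of a partial additive map: for a subgroup it is
enough to test single-valuedness at 0. *)
Definition single_valued (X Y : zmodType) (G : set (X * Y)) : Prop :=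
  forall y, qspan G (0, y) -> y = 0.

Lemma pair_mulrn (X Y : zmodType) (x : X) (y : Y) n :
  (x, y) *+ n = (x *+ n, y *+ n).
Proof. by elim: n => [|n IHn]; rewrite ?mulr0n// !mulrS IHn. Qed.

Lemma pair_mulrz (X Y : zmodType) (x : X) (y : Y) (m : int) :
  (x, y) *~ m = (x *~ m, y *~ m).
Proof. by case: m => n; rewrite /intmul/= pair_mulrn. Qed.

Lemma divisible_intmul (V : zmodType) (m : int) (x : V) :
  divisible V -> m != 0 -> exists y, y *~ m = x.
Proof.
move=> divV; case: m => [[//|n] _|n _]; first exact: divV.
by have [y yE] := divV n (- x); exists y; rewrite NegzE mulrNz -pmulrn yE opprK.
Qed.

(** A point (0, y) of the larger span is a combination with coefficient m of
(x, y0).  If m <> 0, divisibility of Y gives y' with (m x, m y') in the span of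
G, hence (x, y') in it by purity, which puts x in the domain. *)
Lemma single_valued_adjoin (X Y : zmodType) (G : set (X * Y)) x y0 :
  divisible Y -> single_valued G -> (forall y, ~ qspan G (x, y)) ->
  single_valued (G `|` [set (x, y0)]).
Proof.
move=> divY sG Gx y /qspan_setU1[n [m]].
have [-> |m0] := eqVneq m 0.
  rewrite mulr0z subr0 => Gy; apply: sG.
  by case: (qspan_pure G) => _ _; apply; exact: Gy.
rewrite pair_mulrn pair_mulrz mul0rn => /(pureN (qspan_pure G)) Gxy.
have [y' y'E] := divisible_intmul (y0 *~ m - y *+ n.+1) divY m0.
case: (Gx y'); apply: (pure_divz (qspan_pure G) m0).
rewrite pair_mulrz y'E.
suff -> : (x *~ m, y0 *~ m - y *+ n.+1) =
  - ((0, y *+ n.+1) - (x *~ m, y0 *~ m)) by [].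
by rewrite opprB; congr (_, _); rewrite /= subr0.
Qed.

Lemma single_valued_chain (X Y : zmodType) (B : set (X * Y))
    (F : set (set (X * Y))) :
  total_on F subset -> single_valued B ->
  (forall A, F A -> single_valued (B `|` A)) ->
  single_valued (B `|` \bigcup_(A in F) A).
Proof.
move=> totF sB sF y /qspan_bigcup_chain-/(_ totF)[/sB//|[A FA]].
exact: sF.
Qed.

(** By Zorn's lemma there is a largest way of adding points while keeping the
span single valued; by [single_valued_adjoin] its domain is then everything. *)
Lemma additive_extension (X Y : zmodType) (G : set (X * Y)) :
  divisible Y -> single_valued G ->
  exists F : X -> Y,
    (forall x u, F (x + u) = F x + F u) /\ forall z, G z -> F z.1 = z.2.
Proof.
move=> divY sG.
have [F FP totF|H [sH Hmax]] :=
    @Zorn_bigcup _ [set H | single_valued (G `|` H)].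
  exact: single_valued_chain.
have pS := qspan_pure (G `|` H).
have dom x : exists y, qspan (G `|` H) (x, y).
  apply: contrapT => /forallNP nx.
  apply: (Hmax (H `|` [set (x, 0)])); last first.
    by rewrite /= setUA; exact: single_valued_adjoin.
  split; first by move=> ?; left.
  move=> /(_ (x, 0)) xH; apply: (nx 0).
  by apply: sub_qspan; right; apply: xH; right.
have [F FS] := choice dom.
have uniqF x y : qspan (G `|` H) (x, y) -> F x = y.
  move=> xy; apply/esym/eqP; rewrite -subr_eq0; apply/eqP/sH.
  suff -> : (0, y - F x) = (x, y) - (x, F x) :> X * Y.
    by case: pS => _ SB _; exact: SB.
  by rewrite -[RHS]/(x - x, y - F x) subrr.
exists F; split=> [x u|[x y] Gz]; last by apply: uniqF; apply: sub_qspan; left.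
apply: uniqF; rewrite -[(_, _)]/((x, F x) + (u, F u)).
exact: (pureD pS (FS x) (FS u)).
Qed.

(** The points are chosen by transfinite recursion. That the span of those
chosen up to i is single valued follows by induction on i, being a union of a
chain followed by the adjunction of one point whose first coordinate is new. *)
Lemma additive_transversal (X Y : zmodType) (I : Type) (lt : I -> I -> Prop)
    (K : I -> set (X * Y)) :
  divisible Y -> torsion_free Y ->
  well_founded lt -> (forall i j k, lt i j -> lt j k -> lt i k) ->
  (forall i j, [\/ lt i j, i = j | lt j i]) ->
  (forall i (f : I -> X * Y), exists z,
    K i z /\ forall y, ~ qspan (f @` [set j | lt j i]) (z.1, y)) ->
  exists F : X -> Y, (forall x u, F (x + u) = F x + F u) /\
    forall i, exists x, K i (x, F x).
Proof.
move=> divY torY wf ltT ltC stepK.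
have [z zP] := @well_founded_choice _ _ (0, 0) lt
  (fun i S z => K i z /\ forall y, ~ qspan S (z.1, y)) wf stepK.
pose le i j := lt j i \/ j = i.
have chain (J : set I) :
    total_on [set z @` [set j | le i j] | i in J] subset.
  move=> _ _ [i _ <-] [k _ <-].
  have mono i' k' : lt i' k' ->
      z @` [set j | le i' j] `<=` z @` [set j | le k' j].
    move=> ik _ [j ji <-]; exists j => //; left.
    by case: ji => [/ltT|->]; [apply|].
  by case: (ltC i k) => [ik|->|ki]; [left; exact: mono|left|right; exact: mono].
have sv0 : single_valued (set0 : set (X * Y)).
  move=> y; apply: (@qspan_min _ _ [set z | z.2 = 0]) => //.
  split=> // [[x u] [x' u'] /= -> ->|n [x u]]; first by rewrite subr0.
  by rewrite pair_mulrn => /torY.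
have sv_bigcup (J : set I) :
    (forall i, J i -> single_valued (z @` [set j | le i j])) ->
    single_valued (z @` [set j | exists2 i, J i & le i j]).
  move=> sJ; rewrite (_ : z @` _ =
      set0 `|` \bigcup_(A in [set z @` [set j | le i j] | i in J]) A).
    apply: single_valued_chain => // _ [i Ji <-]; rewrite set0U; exact: sJ.
  rewrite set0U; apply/seteqP.
  split=> [_ [j [i Ji ij] <-]|_ [_ [i Ji <-] [j ij <-]]].
    by exists (z @` [set j | le i j]); [exists i|exists j].
  by exists j => //; exists i.
have svle i : single_valued (z @` [set j | le i j]).
  elim/(well_founded_ind wf): i => i IHi.
  rewrite (_ : z @` _ = z @` [set j | lt j i] `|` [set ((z i).1, (z i).2)]).
    apply: single_valued_adjoin => //; last by case: (zP i).
    rewrite (_ : [set j | lt j i] = [set j | exists2 k, lt k i & le k j]).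
      exact: sv_bigcup.
    apply/seteqP; split=> [j ji|j [k ki [jk|->//]]]; last exact: ltT ki.
    by exists j => //; right.
  rewrite -surjective_pairing; apply/seteqP; split.
    by move=> _ [j [ji|->] <-]; [left; exists j|right].
  by move=> _ [[j ji <-]|->]; [exists j => //; left|exists i => //; right].
have svT : single_valued (range z).
  rewrite (_ : [set: I] = [set j | exists2 i, [set: I] i & le i j]).
    by apply: sv_bigcup => i _.
  by apply/seteqP; split=> // i _; exists i => //; right.
have [F [Fadd FG]] := additive_extension divY svT.
exists F; split=> // i; exists (z i).1.
by rewrite FG; [rewrite -surjective_pairing; case: (zP i)|exists i].
Qed.

(** * Additive maps meeting a continuum of prescribed sets *)

Lemma morph_mulrn (V W : zmodType) (phi : V -> W) :
  {morph phi : u v / u - v} -> forall v n, phi (v *+ n) = phi v *+ n.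
Proof.
move=> phiB v; have phi0 : phi 0 = 0 by have := phiB 0 0; rewrite !subrr.
have phiN u : phi (- u) = - phi u by rewrite -sub0r phiB phi0 sub0r.
have phiD u w : phi (u + w) = phi u + phi w.
  by rewrite -{1}[w]opprK phiB phiN opprK.
by elim=> [|n IHn]; rewrite ?mulr0n// !mulrS phiD IHn.
Qed.

(** The image of a rational subspace under an injective additive map into a
torsion-free group is pure, the reals being divisible. *)
Lemma independent_image (R : realType) (X : zmodType) (I : Type) (t : I -> R)
    (phi : R -> X) :
  torsion_free X -> {morph phi : u v / u - v} -> injective phi ->
  independent t -> independent (phi \o t).
Proof.
move=> torX phiB phi_inj tI i.
have phi0 : phi 0 = 0 by have := phiB 0 0; rewrite !subrr.
have phiMn := morph_mulrn phiB.
have pS := qspan_pure (t @` [set j | j <> i]); case: (pS) => S0 SB SM.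
move=> phit.
have [] : (phi @` qspan (t @` [set j | j <> i])) ((phi \o t) i).
  apply: qspan_min phit; last first.
    move=> _ [j ji <-]; exists (t j) => //; apply: sub_qspan; exact: imageP.
  split.
  - by exists 0.
  - by move=> _ _ [u Su <-] [v Sv <-]; exists (u - v); [exact: SB|exact: phiB].
  - move=> n x [u Su ux].
    have uE : u = (u / n.+1%:R) *+ n.+1.
      by rewrite -mulr_natr divfK ?pnatr_eq0.
    exists (u / n.+1%:R); first by apply: (SM n); rewrite -uE.
    apply/eqP; rewrite -subr_eq0; apply/eqP/(torX n).
    by rewrite mulrnBl -phiMn -uE ux subrr.
by move=> u Su /phi_inj uE; apply: (tI i); rewrite -uE.
Qed.

(** If at some stage every admissible x were in the span of the first
coordinates A already chosen, then so would be the whole line phi i, and with it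
the independent family of branch reals. The exchange lemma would then inject all
binary sequences, hence by code all of I, into the segment below i. *)
Lemma additive_hitting (R : realType) (X Y : zmodType) (I : Type)
    (code : I -> nat -> bool) (K : I -> set (X * Y)) (a : I -> X)
    (phi : I -> R -> X) :
  torsion_free X -> torsion_free Y -> divisible Y -> injective code ->
  (forall i, {morph phi i : u v / u - v}) -> (forall i, injective (phi i)) ->
  (forall i s, -1 <= s <= 1 -> exists y, K i (a i + phi i s, y)) ->
  exists F : X -> Y, (forall x u, F (x + u) = F x + F u) /\
    forall i, exists x, K i (x, F x).
Proof.
move=> torX torY divY code_inj phiB phi_inj KE.
have [lt [lt_wf lt_trans lt_tri lt_small]] := small_segments_well_order I.
apply: (additive_transversal divY torY lt_wf lt_trans lt_tri) => i f.
apply: contrapT => nz.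
pose J := [set j | lt j i].
pose A := (fst \o f) @` J.
have pA := qspan_pure A; case: (pA) => A0 AB AM.
(* the preimage of a pure subgroup under the first projection is pure, so the
   first coordinates of a span are in the span of the first coordinates *)
have aphiA s : -1 <= s <= 1 -> qspan A (a i + phi i s).
  move=> /(KE i)[y Ky].
  have [y' fy'] : exists y', qspan (f @` J) (a i + phi i s, y').
    apply: contrapT => /forallNP nS; apply: nz.
    by exists (a i + phi i s, y).
  apply: (qspan_min (W := [set z | qspan A z.1]) _ _ fy').
    split=> [//|[x1 y1] [x2 y2]|n [x1 y1]]; first exact: AB.
    by rewrite /= pair_mulrn; exact: AM.
  by move=> _ [j ji <-]; apply: sub_qspan; exists j.
have phi0 : phi i 0 = 0 by have := phiB i 0 0; rewrite !subrr.
have aA : qspan A (a i).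
  by have := aphiA 0; rewrite phi0 addr0 oppr_le0 ler01; apply.
have phiA s : -1 <= s <= 1 -> qspan A (phi i s).
  by move=> /aphiA aphi; rewrite -[phi i s](addKr (a i)) addrC; exact: AB.
have phiMn := morph_mulrn (phiB i).
(* t is a multiple of a real in [-1, 1] *)
have lineA t : qspan A (phi i t).
  have [n tn] : exists n, `|t| <= n.+1%:R.
    exists (Num.truncn `|t|); exact/ltW/truncnS_gt.
  have -> : t = (t / n.+1%:R) *+ n.+1.
    by rewrite -mulr_natr divfK ?pnatr_eq0.
  rewrite phiMn; apply: (pureMn _ pA); apply: phiA.
  by rewrite -ler_norml normrM normfV normr_nat ler_pdivrMr// mul1r.
have [g [g_inj gA]] := steinitz_exchange
  (independent_image torX (phiB i) (phi_inj i) (@branch_real_independent R))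
  (fun x => lineA _).
have /choice[h hP] x : exists j, J j /\ (f j).1 = g x.
  by have [j Jj jE] := gA x; exists j.
apply: (lt_small i (h \o code)).
  apply: inj_comp code_inj => x y hxy; apply: g_inj.
  by rewrite -(hP x).2 -(hP y).2 hxy.
by move=> j; exact: (hP _).1.
Qed.

(** At most continuum many elements; binary sequences are the form of the
continuum that indexes the independent reals. *)
Definition has_code (T : Type) : Prop :=
  exists c : T -> nat -> bool, injective c.

Lemma has_code_inj (T U : Type) (f : T -> U) :
  injective f -> has_code U -> has_code T.
Proof. by move=> f_inj [c c_inj]; exists (c \o f); exact: inj_comp. Qed.

Lemma has_code_pred (J : countType) : has_code (J -> bool).
Proof.
exists (fun D n => if unpickle n is Some j then D j else false) => D E DE.
by apply/funext => j; have := congr1 (@^~ (pickle j)) DE; rewrite pickleK.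
Qed.

Lemma has_code_prod (T U : Type) :
  has_code T -> has_code U -> has_code (T * U).
Proof.
move=> [c c_inj] [d d_inj].
apply: (@has_code_inj _ (bool * nat -> bool)
  (fun p q => if q.1 then c p.1 q.2 else d p.2 q.2)); last exact: has_code_pred.
move=> [t u] [t' u'] pp'; congr (_, _).
  by apply: c_inj; apply/funext => n; exact: (congr1 (@^~ (true, n)) pp').
by apply: d_inj; apply/funext => n; exact: (congr1 (@^~ (false, n)) pp').
Qed.

(** A real is determined by the rationals below it. *)
Lemma has_code_real (R : realType) : has_code R.
Proof.
apply: (@has_code_inj _ (rat -> bool) (fun x q => ratr q < x)); last first.
  exact: has_code_pred.
have cut (x y : R) : x < y -> (fun q => ratr q < x) <> (fun q => ratr q < y).
  move=> xy cutE; have [q] := rat_in_itvoo xy.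
  rewrite in_itv /= => /andP[xq qy].
  by have := congr1 (@^~ q) cutE; rewrite qy ltNge (ltW xq).
by move=> x y cutE; case: (ltgtP x y) => // /cut; [|move/nesym].
Qed.

Lemma has_code_card (R : realType) (T : Type) :
  ([set: T] #<= [set: R])%card -> has_code T.
Proof.
move=> /pcard_injP[f f_inj].
apply: (@has_code_inj _ R f); last exact: has_code_real.
by move=> x y; apply: f_inj; rewrite inE.
Qed.

(** * Real lines in topological vector spaces *)

Definition real_scalar (R : realType) (k : scalar_kind) : R -> scalars R k :=
  match k with
  | RealScalars => id
  | ComplexScalars => fun t => t%:C%C
  end.
Arguments real_scalar {R} k t.

Lemma real_scalarB (R : realType) k :
  {morph @real_scalar R k : u v / u - v}.
Proof. by case: k => u v //=; rewrite rmorphB. Qed.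

Lemma real_scalarM (R : realType) k :
  {morph @real_scalar R k : u v / u * v}.
Proof. by case: k => u v //=; rewrite rmorphM. Qed.

Lemma real_scalar0 (R : realType) k : real_scalar k (0 : R) = 0.
Proof. by case: k. Qed.

Lemma real_scalar1 (R : realType) k : real_scalar k (1 : R) = 1.
Proof. by case: k. Qed.

Lemma real_scalar_eq0 (R : realType) k (t : R) :
  (real_scalar k t == 0) = (t == 0).
Proof. by case: k => //=; rewrite eq_complex /= eqxx andbT. Qed.

(** On the real axis the modulus of a complex number is the absolute value. *)
Lemma real_scalar_continuous (R : realType) k :
  continuous (real_scalar k : R -> (scalars R k)^o).
Proof.
case: k => [x|x]; first exact: cvg_id.
apply/cvgrPdist_lt => e e0.
have [eR eE] : exists r, e = r%:C%C.
  exists (complex.Re e); apply/esym/eqP; rewrite eq_complex /= eqxx.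
  by move: e0; rewrite ltcE/= => /andP[/eqP ->].
near=> t.
rewrite /real_scalar -rmorphB /= normc_def /= expr0n /= addr0 sqrtr_sqr eE.
rewrite ltcR.
near: t.
apply: (@cvgr_dist_lt _ _ _ _ _ id) => //; move: e0; rewrite eE ltcR.
exact.
Unshelve. all: end_near. Qed.

Definition real_line (R : realType) k (V : topologicalLmodType (scalars R k))
  (a v : V) (t : R) : V := a + real_scalar k t *: v.

Lemma real_line_continuous (R : realType) k
    (V : topologicalLmodType (scalars R k)) (a v : V) :
  continuous (real_line a v).
Proof.
move=> t; rewrite /real_line /continuous_at.
apply: (@continuous_comp _ _ _ (fun t => (a, real_scalar k t *: v))
  (fun x : V * V => x.1 + x.2)); last exact: add_continuous.
apply: cvg_pair; first exact: cvg_cst.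
apply: (@continuous_comp R ((scalars R k)^o * V)%type V
  (fun t => (real_scalar k t, v)) (fun x => x.1 *: x.2)).
  apply: (@cvg_pair _ _ _ _ (nbhs (real_scalar k t : (scalars R k)^o))).
    exact: real_scalar_continuous.
  exact: cvg_cst.
exact: scale_continuous.
Qed.

Lemma real_line0 (R : realType) k (V : topologicalLmodType (scalars R k))
  (a v : V) : real_line a v 0 = a.
Proof. by rewrite /real_line real_scalar0 scale0r addr0. Qed.

Lemma real_line1 (R : realType) k (V : topologicalLmodType (scalars R k))
  (a b : V) : real_line a (b - a) 1 = b.
Proof. by rewrite /real_line real_scalar1 scale1r addrC subrK. Qed.

(** The same direction, scaled down until the parameter interval [-1, 1] stays
in the neighbourhood. *)
Lemma real_line_shrink (R : realType) k (V : topologicalLmodType (scalars R k))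
  (a v : V) (N : set V) : v != 0 -> nbhs a N ->
  exists e, e != 0 /\ forall s, -1 <= s <= 1 -> N (real_line a e s).
Proof.
move=> v0 aN; have := @real_line_continuous R k V a v 0.
rewrite /continuous_at real_line0 => /(_ _ aN) /nbhs_ballP[/= d d0 dN].
have d20 : 0 < d / 2 by rewrite divr_gt0.
exists (real_scalar k (d / 2) *: v); split.
  by rewrite scaler_eq0 negb_or real_scalar_eq0 (gt_eqF d20).
move=> s s1.
rewrite (_ : real_line _ _ _ = real_line a v (s * (d / 2))); last first.
  by rewrite /real_line scalerA -real_scalarM.
apply: dN; rewrite /ball/= sub0r normrN normrM (gtr0_norm d20).
apply: (@le_lt_trans _ _ (d / 2)); last by rewrite gtr_pMr// invf_lt1 ?ltr1n.
by rewrite ler_piMl ?(ltW d20)// ler_norml.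
Qed.

Lemma real_open_cover_meet (R : realType) (P Q : set R) :
  open P -> open Q -> P !=set0 -> Q !=set0 -> (forall t, P t \/ Q t) ->
  exists t, P t /\ Q t.
Proof.
move=> oP oQ P0 [q Qq] PQ; apply: contrapT => /forallNP nPQ.
have : connected [set: R] by apply/connected_intervalP => ? ? _ _ ? _.
move=> /(_ P P0) PT; have {PT}PT : P = setT.
  apply: PT.
- by exists P => //; rewrite setTI.
- exists (~` Q); first exact: open_closedC.
  rewrite setTI; apply/seteqP; split=> [t Pt Qt|t nQt]; first exact: (nPQ t).
  by case: (PQ t).
- by apply: (nPQ q); split=> //; rewrite PT.
Qed.

Definition rational_ball (R : realType) (j : rat * rat * nat) : set (R * R) :=
  ball ((ratr j.1.1, ratr j.1.2) : R * R) j.2.+1%:R^-1.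
Arguments rational_ball R j : clear implicits.

Lemma open_rational_balls (R : realType) (D : set (R * R)) : open D ->
  D = \bigcup_(j in [set j | rational_ball R j `<=` D]) rational_ball R j.
Proof.
move=> oD; apply/seteqP; split=> [[s r] Dsr|z [j jD jz]]; last exact: jD.
have /nbhs_ballP[/= e e0 eD] : nbhs (s, r) D by exact: open_nbhs_nbhs.
have [n ne] : exists n, (n.+1%:R^-1 : R) < e / 2.
  have e2 : 0 < (e / 2)^-1 by rewrite invr_gt0 divr_gt0.
  exists (Num.truncn (e / 2)^-1).
  rewrite invf_plt ?posrE ?divr_gt0//; exact: truncnS_gt.
have n0 : (0 : R) < n.+1%:R^-1 by rewrite invr_gt0.
have approx (t : R) : exists q : rat, `|ratr q - t| < n.+1%:R^-1.
  have [|q] := @rat_in_itvoo R (t - n.+1%:R^-1) (t + n.+1%:R^-1).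
    by rewrite ltrBlDr -addrA ltrDl addr_gt0.
  by rewrite in_itv /= => tq; exists q; rewrite ltr_distl.
have [p ps] := approx s; have [q qr] := approx r.
exists (p, q, n); last by split; rewrite /ball/=.
move=> z pz; apply: eD.
have : ball ((s, r) : R * R) (n.+1%:R^-1 + n.+1%:R^-1) z.
  apply: ball_triangle pz; apply: ball_sym.
  by split; rewrite /ball/=.
by apply: le_ball; rewrite [leRHS]splitr ltW// ltrD.
Qed.

(** * Connected and dense graphs *)

(** The closed complement of D, restricted to |s| <= 1, is carried into X * Y by
(s, r) |-> (a + s e, b + r f).  If it meets every vertical line over [-1, 1],
then its image has to meet the graph of F. *)
Definition strip_hitting (R : realType) (kX kY : scalar_kind)
    (X : topologicalLmodType (scalars R kX))
    (Y : topologicalLmodType (scalars R kY)) (F : X -> Y) : Prop :=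
  forall (a e : X) (b f : Y) (D : set (R * R)), e != 0 -> open D ->
  (forall s, -1 <= s <= 1 -> exists r, ~ D (s, r)) ->
  exists s r, [/\ -1 <= s <= 1, ~ D (s, r) &
    F (real_line a e s) = real_line b f r].

Lemma lmodule_torsion_free (K : numFieldType) (V : lmodType K) : torsion_free V.
Proof.
move=> n x; rewrite -scaler_nat => /eqP; rewrite scaler_eq0 pnatr_eq0 /=.
by move/eqP.
Qed.

Lemma lmodule_divisible (K : numFieldType) (V : lmodType K) : divisible V.
Proof.
move=> n x; exists (n.+1%:R^-1 *: x).
by rewrite -scaler_nat scalerA mulfV ?scale1r ?pnatr_eq0.
Qed.

(** A requirement consists of four vectors and a set of rational balls, the
latter standing for their union; all of these can be coded by binary sequences.
*)
Lemma strip_hitting_exists (R : realType) (kX kY : scalar_kind)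
    (X : topologicalLmodType (scalars R kX))
    (Y : topologicalLmodType (scalars R kY)) :
  ([set: X] #<= [set: R])%card -> ([set: Y] #<= [set: R])%card ->
  exists F : X -> Y, (forall x u, F (x + u) = F x + F u) /\ strip_hitting F.
Proof.
move=> cX cY.
pose region (c : rat * rat * nat -> bool) : set (R * R) :=
  \bigcup_(j in [set j | c j]) rational_ball R j.
pose datum := (X * X * (Y * Y) * (rat * rat * nat -> bool))%type.
pose valid (p : datum) := p.1.1.2 != 0 /\
  forall s, -1 <= s <= 1 -> exists r, ~ region p.2 (s, r).
pose I := {p : datum | valid p}.
have [code code_inj] : has_code I.
  apply: (@has_code_inj _ datum (@proj1_sig _ _)).
    by move=> [p vp] [q vq] /= pq; exact: eq_exist.
  have hX := has_code_card cX; have hY := has_code_card cY.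
  apply: has_code_prod; last exact: has_code_pred.
  by apply: has_code_prod; exact: has_code_prod.
pose K (i : I) : set (X * Y) := let p := proj1_sig i in
  [set z | exists s r, [/\ -1 <= s <= 1, ~ region p.2 (s, r),
     z.1 = real_line p.1.1.1 p.1.1.2 s & z.2 = real_line p.1.2.1 p.1.2.2 r]].
have [] := @additive_hitting R X Y I code K (fun i => (proj1_sig i).1.1.1)
  (fun i t => real_scalar kX t *: (proj1_sig i).1.1.2).
- exact: lmodule_torsion_free.
- exact: lmodule_torsion_free.
- exact: lmodule_divisible.
- exact: code_inj.
- by move=> i u v; rewrite real_scalarB scalerBl.
- move=> [p [e0 pP]] u v /= /eqP; rewrite -subr_eq0 -scalerBl -real_scalarB.
  by rewrite scaler_eq0 real_scalar_eq0 (negbTE e0) orbF subr_eq0 => /eqP.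
- move=> [p [e0 pP]] s s1; have [r sr] := pP s s1.
  by exists (real_line p.1.2.1 p.1.2.2 r), s, r.
move=> F [Fadd FK]; exists F; split=> // a e b f D e0 oD DP.
pose c j := `[< rational_ball R j `<=` D >].
have cD : region c = D.
  rewrite [RHS](open_rational_balls oD); congr bigcup.
  by apply/seteqP; split=> j /= /asboolP.
have vp : valid (a, e, (b, f), c) by split=> //=; rewrite cD.
have [x [s [r /= [s1 sr xE FE]]]] := FK (exist _ _ vp).
by exists s, r; split=> //; [rewrite -cD|rewrite -xE].
Qed.

(** With f = 0 the strip degenerates to a horizontal segment through (a, b),
which is short enough to remain in the given open set. *)
Lemma strip_hitting_dense (R : realType) (kX kY : scalar_kind)
    (X : topologicalLmodType (scalars R kX))
    (Y : topologicalLmodType (scalars R kY)) (F : X -> Y) :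
  (exists v : X, v != 0) -> strip_hitting F -> dense (graph F).
Proof.
move=> [v v0] hitF O [[a b] Oab] oO.
have [[A B] /= [aA bB] ABO] : nbhs (a, b) O by exact: open_nbhs_nbhs.
have [e [e0 eA]] := real_line_shrink v0 aA.
have [|s [r [s1 _ FE]]] := hitF a e b 0 set0 e0 open0.
  by move=> s _; exists 0.
exists (real_line a e s, F (real_line a e s)); split; last first.
  by exists (real_line a e s).
apply: ABO; split; first exact: eA.
by rewrite /= FE /real_line scaler0 addr0; exact: nbhs_singleton.
Qed.

Lemma open_slice1 (T U : topologicalType) (W : set (T * U)) (b : U) :
  open W -> open [set x | W (x, b)].
Proof.
by apply: (@open_comp _ _ (fun x => (x, b))) => x _; apply: cvg_pair;
  [exact: cvg_id|exact: cvg_cst].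
Qed.

Lemma open_slice2 (T U : topologicalType) (W : set (T * U)) (a : T) :
  open W -> open [set y | W (a, y)].
Proof.
by apply: (@open_comp _ _ (fun y => (a, y))) => y _; apply: cvg_pair;
  [exact: cvg_cst|exact: cvg_id].
Qed.

(** Density makes the two separating open sets disjoint.  The strip is chosen so
that each of its vertical lines meets both of them, hence also leaves their
union. *)
Lemma strip_hitting_connected (R : realType) (kX kY : scalar_kind)
    (X : topologicalLmodType (scalars R kX))
    (Y : topologicalLmodType (scalars R kY)) (F : X -> Y) :
  (exists v : X, v != 0) -> strip_hitting F -> connected (graph F).
Proof.
move=> [v v0] hitF B [z Bz] [U oU BU] [C cC BC].
have dF := strip_hitting_dense (ex_intro _ v v0) hitF.
(* B is the trace on the graph of U and also of C; if it is proper, then U and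
   the complement V of C separate the graph *)
apply: contrapT => BG.
pose V := ~` C; have oV : open V by exact: closed_openC.
have UV w : graph F w -> U w \/ V w.
  move=> Gw; have [Cw|nCw] := EM (C w); last by right.
  by left; have : B w by [rewrite BC]; rewrite BU => -[].
have nUV w : U w -> V w -> False.
  move=> Uw Vw; have [||w' [[Uw' Vw'] Gw']] := dF (U `&` V).
  - by exists w.
  - exact: openI.
  - by apply: Vw'; have : B w' by [rewrite BU]; rewrite BC => -[].
have [w Gw Vw] : exists2 w, graph F w & V w.
  apply: contrapT => nV; apply: BG; rewrite BC; apply/seteqP; split.
    by move=> w [].
  by move=> w Gw; split=> //; apply: contrapT => nCw; apply: nV; exists w.
have [Uz _] : U z /\ graph F z by move: Bz; rewrite BU => -[].
(* along the line x from z in U to w in V, the parameters whose vertical fibre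
   meets U, respectively V, overlap *)
pose x t := real_line z.1 (w.1 - z.1) t.
pose P (W : set (X * Y)) := \bigcup_y [set t | W (x t, y)].
have oP W : open W -> open (P W).
  move=> oW; apply: bigcup_open => y _.
  apply: open_comp (open_slice1 y oW) => t _; exact: real_line_continuous.
have [||t|t0 [[b _ Ub] [d _ Vd]]] := real_open_cover_meet (oP _ oU) (oP _ oV).
- by exists 0; exists z.2 => //; rewrite /= /x real_line0 -surjective_pairing.
- by exists 1; exists w.2 => //; rewrite /= /x real_line1 -surjective_pairing.
- by have [|xU|xV] := UV (x t, F (x t)); [exists (x t)|left; exists (F (x t))|
    right; exists (F (x t))].
set a := x t0 in Ub Vd.
have [e [e0 eUV]] := real_line_shrink v0 (filterI
  (open_nbhs_nbhs (conj (open_slice1 b oU) Ub))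
  (open_nbhs_nbhs (conj (open_slice1 d oV) Vd))).
pose strip (p : R * R) := (real_line a e p.1, real_line b (d - b) p.2).
have strip_cont : continuous strip.
  move=> p; apply: cvg_pair.
    apply: (@continuous_comp _ _ _ fst (real_line a e)); first exact: cvg_fst.
    exact: real_line_continuous.
  apply: (@continuous_comp _ _ _ snd (real_line b (d - b))).
    exact: cvg_snd.
  exact: real_line_continuous.
have oD W : open W -> open (strip @^-1` W).
  by apply: open_comp => p _; exact: strip_cont.
have [|s [r [s1 sr Fsr]]] := hitF a e b (d - b)
    (strip @^-1` U `|` strip @^-1` V) e0 (openU (oD _ oU) (oD _ oV)).
  move=> s /eUV[/= Usb Vsd]; apply: contrapT => /forallNP sD.
  pose Q (W : set (X * Y)) := [set r | W (strip (s, r))].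
  have oQ W : open W -> open (Q W) by move=> /oD; exact: open_slice2.
  have [||r|r [Ur Vr]] := real_open_cover_meet (oQ _ oU) (oQ _ oV).
  - by exists 0; rewrite /Q /strip /= real_line0.
  - by exists 1; rewrite /Q /strip /= real_line1.
  - by apply: contrapT => nUVr; apply: (sD r).
  - exact: nUV Ur Vr.
apply: sr; have := UV (real_line a e s, F (real_line a e s)).
by rewrite /= /strip /= -Fsr; apply; exists (real_line a e s).
Qed.

Theorem theorem5 (R : realType) (kX kY : scalar_kind)
    (X : topologicalLmodType (scalars R kX))
    (Y : topologicalLmodType (scalars R kY))
    (metrizableX : metrizable R X) (metrizableY : metrizable R Y)
    (cardX : ([set: X] #= [set: R])%card)
    (cardY : ([set: Y] #= [set: R])%card) :
  exists F : X -> Y,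
    [/\ forall x u : X, F (x + u) = F x + F u,
        connected (graph F)
      & dense (graph F)].
Proof.
have X0 : exists v : X, v != 0.
  apply: contrapT => /forallNP X0.
  have XE (x : X) : x = 0 by apply/eqP/negP => /negP; exact: X0.
  have /card_bijP[f [g fK gK]] := cardX.
  have g01 : g (SigSub (mem_set I : 0 \in [set: R])) =
             g (SigSub (mem_set I : 1 \in [set: R])).
    by apply: val_inj; rewrite [LHS]XE [RHS]XE.
  have /eqP := congr1 val (can_inj gK g01).
  by rewrite /= eq_sym oner_eq0.
have [F [Fadd hitF]] : exists F : X -> Y,
    (forall x u, F (x + u) = F x + F u) /\ strip_hitting F.
  by apply: strip_hitting_exists; [move: cardX|move: cardY];
    rewrite card_eq_le => /andP[].
exists F; split=> //; first exact: strip_hitting_connected.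
exact: strip_hitting_dense.
Qed.
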